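(* Let $N$ be an even positive integer, let $X(0),X(1),\dots,X(N/2-1)$ be real numbers, and let $$J(\tau)=2\sum_{u=0}^{N/2-1}X(u)\Bigl(1+\cos\bigl(\tfrac{2\pi}{N}\tau u\bigr)\Bigr),\qquad \tau=0,1,\dots,N-1.$$ Then $X$ can be calculated from $J$ as follows: $$X(u)=\begin{cases}\dfrac1N\displaystyle\sum_{\tau=0}^{N-1}J(\tau)\cos\bigl(\tfrac{2\pi}{N}\tau u\bigr), & u=1,\dots,N/2-1,\\[2mm] \dfrac1{4N}\displaystyle\sum_{\tau=0}^{N-1}J(\tau)-\dfrac12\sum_{u_1=1}^{N/2-1}X(u_1), & u=0.\end{cases}$$ Moreover, let $$x(u)=\operatorname{Re}\bigl(\mathrm{IFFT}(J)(u)\bigr),\qquad u=1,\dots,N,$$ where $\mathrm{IFFT}$ is applied to the sequence $(J(0),J(1),\dots,J(N-1))$. Then $$X(u)=\begin{cases}x(u+1), & u=1,\dots,N/2-1,\\[1mm] \dfrac1{4N}\displaystyle\sum_{\tau=0}^{N-1}J(\tau)-\dfrac12\sum_{u_1=1}^{N/2-1}X(u_1), & u=0.\end{cases}$$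
   Context: For a sequence $y=(y_1,\dots,y_N)$ of complex numbers, the inverse FFT (MATLAB convention) is the sequence indexed by $u=1,\dots,N$ given by $$\mathrm{IFFT}(y)(u)=\frac1N\sum_{k=1}^{N}y_k\exp\bigl(j\tfrac{2\pi}{N}(k-1)(u-1)\bigr),$$ where $j$ is the imaginary unit. Here $y_k=J(k-1)$ for $k=1,\dots,N$. *)

(* Defs.v *)
From HB Require Import structures.
From mathcomp Require Export all_boot all_order all_algebra.
From mathcomp Require Export complex.
From mathcomp Require Export all_classical all_reals all_analysis.
Export Order.TTheory GRing.Theory Num.Theory numFieldNormedType.Exports.

Set Implicit Arguments.
Unset Strict Implicit.
Unset Printing Implicit Defensive.

Local Open Scope ring_scope.
Local Open Scope complex_scope.

(* MathComp-Analysis only provides the real exponential [expR]. As there, the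
   exponential is the limit of the partial sums of the exponential series; the
   alias [R[i]^o] carries the topology given by the complex modulus. *)
Definition expC (R : realType) (z : R[i]) : R[i] :=
  limn (fun n => (\sum_(0 <= k < n) z ^+ k / k`!%:R) : R[i]^o).

(* Sequences are indexed from 1, as in MATLAB: only y 1, ..., y N are used, and
   IFFT N y u is meant for 1 <= u <= N. *)
Definition IFFT (R : realType) (N : nat) (y : nat -> R[i]) (u : nat) : R[i] :=
  N%:R^-1 * \sum_(1 <= k < N.+1)
    y k * expC ('i * (2 * pi / N%:R * (k%:R - 1) * (u%:R - 1))%:C).

(* Main.v *)
Require Import Defs.
From mathcomp Require Import ring lra zify.

(** The samples [J tau] form a real cosine series in [tau] with frequencies
    [0 <= u < N/2], so [X] is recovered by discrete Fourier inversion. The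
    engine is [sum_cos_eq0]: the real parts of the powers of a nontrivial
    [N]-th root of unity add up to zero over a full period. With the
    product-to-sum formula this makes the cosine vectors of distinct
    frequencies below [N/2] orthogonal ([sum_cos_cos]); the restriction
    to [u, v < N/2] keeps [u + v] below [N], so that no aliasing occurs
    between [u] and [N - v]. Pairing [J] with the vector of frequency [u > 0]
    kills the constant part of [J] and leaves [N * X u]; summing [J] itself
    gives [2 * N * (2 * X 0 + X 1 + ... + X (N/2 - 1))], which is solved for
    [X 0].

    For the inverse FFT, Euler's formula [expC_imaginary] holds because the
    real and imaginary parts of the exponential series at [i * t] are, term by
    term, the cosine and sine series. As [J] is real, the real part of the
    inverse FFT at [u.+1] is exactly the cosine sum of the first part. *)

Local Open Scope ring_scope.
Local Open Scope complex_scope.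

(** * Euler's formula *)

Lemma cvg_Complex (R : realType) (a b : nat -> R) (x y : R) :
  (a n @[n --> \oo] --> x)%classic -> (b n @[n --> \oo] --> y)%classic ->
  (((a n)%:C + 'i%C * (b n)%:C : R[i]^o) @[n --> \oo]
     --> (x%:C + 'i%C * y%:C : R[i]^o))%classic.
Proof.
move=> cva cvb; apply/cvgrPdist_lt => e e0.
(* A positive complex number is real, so the bound can be split in R. *)
have [r er] : exists r : R, e = r%:C by apply/complex_realP; exact: gtr0_real.
move: e0; rewrite er ltcR => r0.
have r20 : 0 < r / 2 by lra.
move/cvgrPdist_lt: cva => /(_ _ r20) cva.
move/cvgrPdist_lt: cvb => /(_ _ r20) cvb.
near=> n.
have -> : (x%:C + 'i%C * y%:C) - ((a n)%:C + 'i%C * (b n)%:C) =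
          (x - a n)%:C + 'i%C * (y - b n)%:C :> R[i].
  by rewrite !rmorphB /=; ring.
apply: (@le_lt_trans _ _ (`|x - a n| + `|y - b n|)%:C).
  apply: le_trans (ler_normD _ _) _.
  rewrite normrM [leRHS](rmorphD (real_complex R)) lerD //.
    by rewrite normc_def /= expr0n /= addr0 sqrtr_sqr.
  by rewrite !normc_def /= !expr0n /= !(addr0, add0r) expr1n sqrtr1 mul1r sqrtr_sqr.
rewrite ltcR.
have ha : `|x - a n| < r / 2 by near: n.
have hb : `|y - b n| < r / 2 by near: n.
lra.
Unshelve. all: by end_near.
Qed.

Lemma exp_term_imaginary (R : realType) (t : R) (k : nat) :
  ('i * t%:C) ^+ k / k`!%:R =
  (cos_coeff t k)%:C + 'i%C * (sin_coeff t k)%:C :> R[i].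
Proof.
have i2 : 'i%C ^+ 2 = -1 :> R[i] by rewrite complexiE sqrCi.
rewrite -complexiE /cos_coeff /sin_coeff /= exprMn.
rewrite !(rmorphM, fmorphV, rmorph_nat, rmorphXn, rmorphN1) /=.
rewrite -{1}[k]odd_double_half -mul2n exprD exprM i2.
case: (boolP (odd k)) => ok /=; last by rewrite expr0; ring.
have -> : k.-1./2 = k./2 by lia.
by rewrite expr1; ring.
Qed.

(** The exponential series at [i * t] converges componentwise to the cosine
    and sine series. *)
Lemma expC_imaginary (R : realType) (t : R) :
  expC ('i * t%:C) = (cos t)%:C + 'i%C * (sin t)%:C.
Proof.
rewrite /expC.
have -> : (fun n => (\sum_(0 <= k < n) ('i * t%:C) ^+ k / k`!%:R) : R[i]^o) =
   (fun n => (series (cos_coeff t) n)%:C + 'i%C * (series (sin_coeff t) n)%:C : R[i]^o).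
  apply/funext => n; rewrite /series /= !rmorph_sum /= mulr_sumr -big_split /=.
  by apply: eq_bigr => k _; exact: exp_term_imaginary.
apply: (@cvg_lim (R[i]^o : ptopologicalType)
  (@norm_hausdorff _ (R[i]^o : normedModType R[i])) nat \oo%classic _).
apply: cvg_Complex.
  by rewrite cos.unlock; exact: is_cvg_series_cos_coeff.
by rewrite sin.unlock; exact: is_cvg_series_sin_coeff.
Qed.

(** The shifts by one in the sampling index and in the output index both
    disappear, since the sequences of the inverse FFT start at 1. *)
Lemma Re_IFFT_real (R : realType) (N : nat) (y : nat -> R) (u : nat) :
  complex.Re (IFFT N (fun k => (y k.-1)%:C) u.+1) =
  N%:R^-1 * \sum_(0 <= tau < N) y tau * cos (2 * pi / N%:R * tau%:R * u%:R).
Proof.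
rewrite /IFFT big_add1 /=.
have natB1 (n : nat) : n.+1%:R - 1 = n%:R :> R by rewrite -natr1 addrK.
under eq_bigr => k _ do rewrite !natB1 expC_imaginary mulrDr mulrCA -!rmorphM.
rewrite big_split /= -mulr_sumr -!rmorph_sum -(rmorph_nat (real_complex R)) -fmorphV /=.
by simpc.
Qed.

(** * Orthogonality of sampled cosines *)

Lemma sum_cos_telescope (R : realType) (th : R) (n : nat) :
  2 * sin (th / 2) * (\sum_(0 <= k < n) cos (k%:R * th)) =
  sin (n%:R * th - th / 2) + sin (th / 2).
Proof.
rewrite mulr_sumr.
rewrite (eq_bigr (fun k => sin (k.+1%:R * th - th / 2) - sin (k%:R * th - th / 2))).
  by rewrite telescope_sumr // mul0r sub0r sinN opprK.
move=> k _.
have -> : k.+1%:R * th - th / 2 = k%:R * th + th / 2 by rewrite -natr1; field.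
by rewrite sinD sinB; ring.
Qed.

(** Multiplying by [2 * sin (th / 2)], with [th = 2 * pi * m / N], makes the sum
    telescope to the difference of sines a full number of turns apart; the
    factor is nonzero since [th / 2] lies strictly between [0] and [pi]. *)
Lemma sum_cos_eq0 (R : realType) (N m : nat) : (0 < m < N)%N ->
  \sum_(0 <= tau < N) cos (2 * pi / N%:R * tau%:R * m%:R) = 0 :> R.
Proof.
case/andP=> m0 mN.
have N_gt0 : (0 < N)%N by lia.
have N0 : 0 < N%:R :> R by rewrite ltr0n.
have Nn0 : N%:R != 0 :> R by rewrite gt_eqF.
set th : R := 2 * pi / N%:R * m%:R.
under eq_bigr => k _ do rewrite mulrAC -/th mulrC.
have s_neq0 : 2 * sin (th / 2) != 0.
  rewrite mulf_neq0 ?pnatr_eq0 // gt_eqF //.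
  have -> : th / 2 = pi * (m%:R / N%:R) by rewrite /th; field.
  apply: sin_gt0_pi; rewrite mulr_gt0 ?pi_gt0 ?divr_gt0 ?ltr0n //=.
  by rewrite gtr_pMr ?pi_gt0 // ltr_pdivrMr // mul1r ltr_nat.
have := sum_cos_telescope R th N.
have -> : N%:R * th - th / 2 = - (th / 2) + pi *+ 2 *+ m.
  by rewrite -(mulr_natr (pi *+ 2)) -(mulr_natr pi) /th; field.
rewrite (periodicn (@sinD2pi R)) sinN addNr => /eqP.
by rewrite mulf_eq0 (negPf s_neq0) => /eqP.
Qed.

(** The product-to-sum formula gives the frequencies [|u - v|] and [u + v], both
    below [N]; the second is positive, and the first is zero only for [u = v]. *)
Lemma sum_cos_cos (R : realType) (N u v : nat) :
  (0 < u < N./2)%N -> (v < N./2)%N ->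
  \sum_(0 <= tau < N) cos (2 * pi / N%:R * tau%:R * v%:R) *
                      cos (2 * pi / N%:R * tau%:R * u%:R)
  = if v == u then N%:R / 2 else 0 :> R.
Proof.
move=> /andP[u0 uN] vN.
(* u - v + (v - u) is the distance between u and v: one of the two truncated
   differences vanishes. *)
have -> : \sum_(0 <= tau < N) cos (2 * pi / N%:R * tau%:R * v%:R) *
                              cos (2 * pi / N%:R * tau%:R * u%:R) =
  (\sum_(0 <= tau < N) cos (2 * pi / N%:R * tau%:R * (u - v + (v - u))%:R) +
   \sum_(0 <= tau < N) cos (2 * pi / N%:R * tau%:R * (u + v)%:R)) / 2 :> R.
  rewrite -big_split mulr_suml /=; apply: eq_bigr => k _.
  set w : R := 2 * pi / N%:R * k%:R.
  have -> : cos (w * (u - v + (v - u))%:R) = cos (w * u%:R - w * v%:R).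
    case: (leqP v u) => [vu|/ltnW uv].
      rewrite (_ : (v - u = 0)%N); last by lia.
      by rewrite addn0 natrB // mulrBr.
    rewrite (_ : (u - v = 0)%N); last by lia.
    by rewrite add0n natrB // mulrBr -cosN opprB.
  by rewrite natrD mulrDr cosB cosD; field.
rewrite (sum_cos_eq0 _ _ (u + v)%N); last by lia.
case: eqP => vu; last by rewrite sum_cos_eq0 ?addr0 ?mul0r //; lia.
have -> : (u - v + (v - u) = 0)%N by lia.
under eq_bigr => k _ do rewrite mulr0 cos0.
by rewrite big_const_nat iter_addr_0 subn0 addr0.
Qed.

(** * Inversion of the cosine series *)

(** Exchanging the two sums leaves one orthogonality relation per frequency,
    after the constant part of [J] has been removed by [sum_cos_eq0]. *)
Lemma cosine_coefficient (R : realType) (N : nat) (X J : nat -> R) (u : nat)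
  (J_def : forall tau : nat, (tau < N)%N ->
     J tau = 2 * \sum_(0 <= u < N./2)
                   X u * (1 + cos (2 * pi / N%:R * tau%:R * u%:R))) :
  (0 < u < N./2)%N ->
  \sum_(0 <= tau < N) J tau * cos (2 * pi / N%:R * tau%:R * u%:R) = N%:R * X u.
Proof.
move=> uN.
under eq_big_nat => k kN do
  rewrite J_def // -mulrA mulr_suml.
rewrite -mulr_sumr exchange_big /=.
rewrite (eq_big_nat _ _ (F2 := fun v => if v == u then X u * (N%:R / 2) else 0)).
  rewrite -big_mkcond big_nat1_eq /= ifT; last by lia.
  by field.
move=> v /andP[_ vN].
under eq_bigr => k _ do rewrite -mulrA mulrDl mul1r.
rewrite -mulr_sumr big_split /= sum_cos_eq0 ?add0r; last by lia.
rewrite sum_cos_cos //.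
by case: eqP => [->//|_]; rewrite mulr0.
Qed.

Lemma sum_samples (R : realType) (N : nat) (X J : nat -> R)
  (J_def : forall tau : nat, (tau < N)%N ->
     J tau = 2 * \sum_(0 <= u < N./2)
                   X u * (1 + cos (2 * pi / N%:R * tau%:R * u%:R))) :
  (1 < N)%N ->
  \sum_(0 <= tau < N) J tau =
  2 * N%:R * (2 * X 0%N + \sum_(1 <= u < N./2) X u).
Proof.
move=> N1.
under eq_big_nat => k kN do rewrite J_def //.
rewrite -mulr_sumr exchange_big /=.
rewrite big_ltn; last by lia.
rewrite -[RHS]mulrA [X in _ = 2 * X]mulrDr mulr_sumr.
congr (2 * (_ + _)).
  under eq_bigr => k _ do rewrite mulr0 cos0.
  by rewrite big_const_nat iter_addr_0 subn0 -mulr_natr; ring.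
apply: eq_big_nat => v vN.
rewrite -mulr_sumr big_split /= sum_cos_eq0 ?addr0; last by lia.
by rewrite big_const_nat iter_addr_0 subn0 mulrC.
Qed.

Theorem proposition2 (R : realType) (N : nat) (X J x : nat -> R)
  (N_gt0 : (0 < N)%N) (N_even : ~~ odd N)
  (J_def : forall tau : nat, (tau < N)%N ->
     J tau = 2 * \sum_(0 <= u < N./2)
                   X u * (1 + cos (2 * pi / N%:R * tau%:R * u%:R)))
  (x_def : forall u : nat, (1 <= u <= N)%N ->
     x u = complex.Re (IFFT N (fun k => (J k.-1)%:C) u)) :
  ((forall u : nat, (1 <= u < N./2)%N ->
      X u = 1 / N%:R *
            \sum_(0 <= tau < N) J tau * cos (2 * pi / N%:R * tau%:R * u%:R)) /\
   X 0%N = 1 / (4 * N%:R) * \sum_(0 <= tau < N) J tau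
           - 1 / 2 * \sum_(1 <= u1 < N./2) X u1) /\
  ((forall u : nat, (1 <= u < N./2)%N -> X u = x u.+1) /\
   X 0%N = 1 / (4 * N%:R) * \sum_(0 <= tau < N) J tau
           - 1 / 2 * \sum_(1 <= u1 < N./2) X u1).
Proof.
have Nn0 : N%:R != 0 :> R by rewrite pnatr_eq0; lia.
have Xu (u : nat) : (1 <= u < N./2)%N -> X u = 1 / N%:R *
    \sum_(0 <= tau < N) J tau * cos (2 * pi / N%:R * tau%:R * u%:R).
  by move=> uN; rewrite (cosine_coefficient _ _ _ _ _ J_def) // mulrA mul1r mulVf // mul1r.
have X0 : X 0%N = 1 / (4 * N%:R) * \sum_(0 <= tau < N) J tau
                  - 1 / 2 * \sum_(1 <= u1 < N./2) X u1.
  rewrite (sum_samples _ _ _ _ J_def); last by lia.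
  by field.
split; split=> // u uN.
by rewrite x_def ?Re_IFFT_real ?Xu ?mul1r //; lia.
Qed.
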